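(* Let $X$ be a complex Hilbert space and $A$ a closed densely defined symmetric operator in $X$ with domain $D_m$; put $D_{\max}:=\operatorname{dom}(A^* )$ with the graph norm. Let $D_W$ be a Hilbert space such that there are continuous inclusions $D_m\hookrightarrow D_W\hookrightarrow D_{\max}\hookrightarrow X$, on $D_m$ the graph norm and the norm of $D_W$ are equivalent, $D_W$ is dense in $D_{\max}$ in the graph norm, and there is a self-adjoint Fredholm extension of $A$ with domain $D$, $D_m\subset D\subset D_W$. Let $\{A_{s,W}:D_W\to X\}_{s\in[0,1]}$ be a continuous curve of bounded operators with $A_{0,W}=A^*|_{D_W}$. If $A_{0,W}$ satisfies weak inner UCP with respect to $D_m$, then $A_{s,W}$ is surjective for all sufficiently small $s$. If, moreover, $$\langle A_{s,W}x,y\rangle=\langle x,A_{s,W}y\rangle\qquad\text{for all }x\in D_m,\ y\in D_W,$$ then for all sufficiently small $s$ the operator $A_{s,W}$ satisfies weak inner UCP with respect to $D_m$.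
   Context: An operator $B$ with domain $D_W\supset D_m$ satisfies the weak inner Unique Continuation Property (UCP) with respect to $D_m$ if $\ker(B|_{D_m})=\{0\}$. *)

(* Defs.v *)
From HB Require Import structures.
From mathcomp Require Import all_boot all_order all_algebra complex.
From mathcomp Require Import all_classical all_reals all_analysis.

Set Implicit Arguments.
Unset Strict Implicit.
Unset Printing Implicit Defensive.

Import Order.TTheory GRing.Theory Num.Theory numFieldNormedType.Exports.

Local Open Scope classical_set_scope.
Local Open Scope ring_scope.
Local Open Scope complex_scope.

(* Complex scalars are R[i] for R : realType, so norms take (nonnegative real)
   values in R[i].  A Hilbert space is a complete normed module over R[i]
   together with an inner product (antilinear in its second argument) that
   induces the norm. *)
Definition hilbert_dot (R : realType) (X : completeNormedModType R[i])
    (ip : {dot X for @Num.conj R[i]}) : Prop :=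
  forall x : X, `|x| ^+ 2 = ip x x.

(* Operators in X that need not be everywhere defined.  The values of fn
   outside dom carry no meaning: two operators are identified when each
   extends the other, see extends below. *)
Record operator (X : Type) := Operator { dom : set X; fn :> X -> X }.

Section Operators.
Variables (R : realType) (X : completeNormedModType R[i]).
Variable ip : {dot X for @Num.conj R[i]}.
Implicit Types (S T : operator X) (x y z : X).

Definition linear_op T : Prop :=
  dom T 0 /\ forall (a : R[i]) x y, dom T x -> dom T y ->
    dom T (a *: x + y) /\ T (a *: x + y) = a *: T x + T y.

Definition extends S T : Prop :=
  dom T `<=` dom S /\ forall x, dom T x -> S x = T x.

Definition densely_defined T : Prop := closure (dom T) = setT.

Definition closed_op T : Prop :=
  closed [set p : X * X | dom T p.1 /\ T p.1 = p.2].

Definition symmetric_op T : Prop :=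
  forall x y, dom T x -> dom T y -> ip (T x) y = ip x (T y).

Definition adjoint_values T y : set X :=
  [set z | forall x, dom T x -> ip (T x) y = ip x z].

(* For densely defined T, adjoint_values T y has at most one element. *)
Definition adjoint T : operator X :=
  Operator [set y | adjoint_values T y !=set0]
           (fun y => xget 0 (adjoint_values T y)).

Definition selfadjoint_op T : Prop :=
  [/\ linear_op T, densely_defined T, extends T (adjoint T)
    & extends (adjoint T) T].

Definition graph_norm T x : R[i] := sqrtC (`|x| ^+ 2 + `|T x| ^+ 2).

Definition finite_dim (V : set X) : Prop :=
  exists (n : nat) (e : 'I_n -> X), forall v, V v ->
    exists c : 'I_n -> R[i], v = \sum_(i < n) c i *: e i.

Definition finite_codim (V : set X) : Prop :=
  exists (n : nat) (e : 'I_n -> X), forall x, exists2 v, V v &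
    exists c : 'I_n -> R[i], x = v + \sum_(i < n) c i *: e i.

Definition fredholm_op T : Prop :=
  [/\ closed_op T, finite_dim [set x | dom T x /\ T x = 0],
      closed (T @` dom T) & finite_codim (T @` dom T)].

End Operators.

Section BoundedOperators.
Variables (R : realType) (W X : completeNormedModType R[i]).
Implicit Types (f : W -> X) (j : W -> X).

Definition bounded_op f : Prop :=
  exists M : R[i], forall w, `|f w| <= M * `|w|.

Definition op_norm f : R :=
  sup [set complex.Re `|f w| | w in [set w | `|w| <= 1]].

Definition continuous_curve (A : R -> {linear W -> X}) : Prop :=
  forall s : R, 0 <= s <= 1 ->
    op_norm (fun w => A t w - A s w) @[t --> within `[0, 1] (nbhs s)] --> 0.

(* j : W -> X is the inclusion of the domain of B into X, so that
   [set w | Dm (j w)] is Dm regarded as a subspace of W. *)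
Definition weak_inner_UCP j (Dm : set X) (B : W -> X) : Prop :=
  [set w | Dm (j w) /\ B w = 0] = [set 0].

End BoundedOperators.

(* The Hilbert space D_W is a type of its own, included in X by the injective
   linear map j; range j is D_W as a subset of X.  That D_max is continuously
   included in X is automatic: `|x| <= graph_norm T x. *)
Record domain_setting (R : realType) (X W : completeNormedModType R[i])
    (ipX : {dot X for @Num.conj R[i]}) (A : operator X)
    (j : {linear W -> X}) : Prop := DomainSetting {
  setting_inj : injective j ;
  setting_Dm_sub_DW : dom A `<=` range j ;
  setting_DW_sub_Dmax : range j `<=` dom (adjoint ipX A) ;
  setting_Dm_DW_cont : exists M : R[i], forall w, dom A (j w) ->
    `|w| <= M * graph_norm A (j w) ;
  setting_DW_Dmax_cont : exists M : R[i], forall w,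
    graph_norm (adjoint ipX A) (j w) <= M * `|w| ;
  setting_equiv : exists c C : R[i], [/\ 0 < c, 0 < C &
    forall w, dom A (j w) ->
      c * `|w| <= graph_norm A (j w) /\ graph_norm A (j w) <= C * `|w|] ;
  setting_dense : forall x, dom (adjoint ipX A) x ->
    forall e : R[i], 0 < e -> exists w,
      graph_norm (adjoint ipX A) (x - j w) < e ;
  setting_selfadjoint : exists B : operator X,
    [/\ selfadjoint_op ipX B, fredholm_op B, extends B A
      & dom B `<=` range j]
}.

(* Main.v *)
(** [A_0 = A^*|_(D_W)] is surjective.  Its range contains the closed, finite
    codimensional range of the self-adjoint Fredholm extension, hence has an
    orthogonal projection, and it remains to see that its orthogonal complement
    vanishes.  As [D_W] is dense in [D_max], a vector [y] orthogonal to the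
    range of [A_0] is orthogonal to the range of [A^*]; so [y] is in the kernel
    of [A^** = A], and [y = 0] by weak inner UCP.

    By Baire's theorem there is [C] such that every [x] is approximated
    arbitrarily well by some [A_0 w] with [|w| <= C |x|].  If
    [|A_s - A_0| < 1 / (4 (C + 1))], then [w] solves [A_s w = x] up to an error
    [|x| / 2], and iterating on the error gives an exact solution.

    Finally, if [A_s x = 0] with [x] in [D_m], the symmetry relation says that
    [x] is orthogonal to the range of [A_s], which is everything. *)

Require Import Defs.
From HB Require Import structures.
From mathcomp Require Import all_boot all_order all_algebra complex.
From mathcomp Require Import all_classical all_reals all_analysis.
From mathcomp Require Import ring lra.

Set Implicit Arguments.
Unset Strict Implicit.
Unset Printing Implicit Defensive.

Import Order.TTheory GRing.Theory Num.Theory numFieldNormedType.Exports.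

Local Open Scope classical_set_scope.
Local Open Scope ring_scope.
Local Open Scope complex_scope.

(** * Geometric bounds and scalar inequalities *)

Lemma geometric_small (R : realType) (C e : R) : 0 < e ->
  exists N, forall n, (N <= n)%N -> C * 2^-1 ^+ n < e.
Proof.
move=> e0.
have h : `|2^-1 : R| < 1 by rewrite gtr0_norm; lra.
have /cvgrPdist_lt/(_ _ e0)[N _ hN] := cvg_geometric C h.
by exists N => n Nn; have := hN _ Nn; rewrite sub0r normrN /=;
  apply: le_lt_trans (ler_norm _).
Qed.

Lemma le_geometric_eq0 (R : realType) (C x : R) :
  0 <= x -> (forall n, x <= C * 2^-1 ^+ n) -> x = 0.
Proof.
move=> x0 h; apply: le_anti; rewrite x0 andbT leNgt.
apply/negP => /geometric_small; move=> /(_ C)[N /(_ _ (leqnn N))].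
by rewrite ltNge h.
Qed.

Lemma half_exp_gt0 (R : realType) n : 0 < 2^-1 ^+ n :> R.
Proof. by rewrite exprn_gt0// invr_gt0. Qed.

(** With [z = q u h] and [b = q h h], these are the two cross terms in the expansion of
    [q (u - t *: h) (u - t *: h)] at the minimizing scalar [t = z / b]. *)
Lemma conj_div_mul (C : numClosedFieldType) (z b : C) : 0 < b ->
  Num.conj (z / b) * z = `|z| ^+ 2 / b /\
  Num.conj (Num.conj (z / b) * z) = `|z| ^+ 2 / b.
Proof.
move=> b0; have bR : Num.conj b = b by rewrite conj_Creal ?gtr0_real.
rewrite !(rmorphM, fmorphV) /= conjCK !bR normCK.
by move: (Num.conj z) => w; split; ring.
Qed.

Lemma sqr_normD_le (C : numDomainType) (a b : C) :
  `|a + b| ^+ 2 <= 2 * `|a| ^+ 2 + 2 * `|b| ^+ 2.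
Proof.
have h : `|a + b| ^+ 2 <= (`|a| + `|b|) ^+ 2.
  by rewrite ler_sqr ?nnegrE ?addr_ge0 ?normr_ge0 ?ler_normD.
apply: (le_trans h); rewrite -subr_ge0.
have -> : 2 * `|a| ^+ 2 + 2 * `|b| ^+ 2 - (`|a| + `|b|) ^+ 2
  = (`|a| - `|b|) ^+ 2 by ring.
by rewrite real_exprn_even_ge0 ?realB ?normr_real.
Qed.

(** * Real-valued norms and completeness with a geometric rate *)

Section RealNorm.
Variables (R : realType) (X : normedModType R[i]).
Implicit Types x y : X.

(** The norm of [X] takes values in [R[i]], which is only partially ordered; its real part allows
    linear arithmetic over [R]. *)
Definition rnorm x : R := complex.Re `|x|.

Lemma rnormE x : (rnorm x)%:C = `|x|.
Proof. by rewrite /rnorm RRe_real// normr_real. Qed.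

Lemma rnorm_ge0 x : 0 <= rnorm x.
Proof. by rewrite -ler0c rnormE. Qed.

Lemma rnorm0 : rnorm 0 = 0.
Proof. by rewrite /rnorm normr0. Qed.

Lemma rnorm_eq0 x : rnorm x = 0 -> x = 0.
Proof. by move=> h; apply/eqP; rewrite -normr_eq0 -rnormE h. Qed.

Lemma rnormN x : rnorm (- x) = rnorm x.
Proof. by rewrite /rnorm normrN. Qed.

Lemma rdistC x y : rnorm (x - y) = rnorm (y - x).
Proof. by rewrite /rnorm distrC. Qed.

Lemma rnormD x y : rnorm (x + y) <= rnorm x + rnorm y.
Proof. by rewrite -lecR rmorphD /= !rnormE ler_normD. Qed.

Lemma rdistD z x y : rnorm (x - y) <= rnorm (x - z) + rnorm (z - y).
Proof. by rewrite -lecR rmorphD /= !rnormE ler_distD. Qed.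

Lemma rnormZ (a : R) x : 0 <= a -> rnorm (a%:C *: x) = a * rnorm x.
Proof.
move=> a0; apply: complexI; rewrite rmorphM /= !rnormE normrZ; congr (_ * _).
by rewrite ger0_norm// lecR.
Qed.

Lemma gt0_realE (e : R[i]) : 0 < e -> 0 < complex.Re e /\ e = (complex.Re e)%:C.
Proof. by case: e => a b; rewrite ltcE /= => /andP[/eqP ->]. Qed.

Lemma cvg_rnorm (u : nat -> X) (l : X) (C : R) :
  (forall n, rnorm (u n - l) <= C * 2^-1 ^+ n) -> u @ \oo --> l.
Proof.
move=> h; apply/cvgrPdist_lt => e /gt0_realE[e0 ->].
have [N hN] := geometric_small C e0.
by exists N => // n /= Nn; rewrite -rnormE ltcR rdistC (le_lt_trans (h n)) ?hN.
Qed.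

End RealNorm.

(** The limit inherits the explicit rate: let [m] tend to infinity in the hypothesis. *)
Lemma rnorm_complete (R : realType) (X : completeNormedModType R[i])
    (u : nat -> X) (C : R) :
  (forall n m, (n <= m)%N -> rnorm (u n - u m) <= C * 2^-1 ^+ n) ->
  exists l, forall n, rnorm (u n - l) <= C * 2^-1 ^+ n.
Proof.
move=> h.
have cu : cvg (u @ \oo).
  apply: cauchy_cvg; apply: cauchy_exP => e /gt0_realE[e0 ->].
  have [N hN] := geometric_small C e0.
  exists (u N); exists N => // n /= Nn; rewrite -ball_normE /= -rnormE ltcR.
  by rewrite (le_lt_trans (h _ _ Nn)) ?hN.
exists (lim (u @ \oo)) => n; apply/ler_addgt0Pr => e e0.
move/cvgrPdist_lt : cu => /(_ e%:C); rewrite ltcR => /(_ e0)[N _ hN].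
have := hN (maxn N n) (leq_maxl _ _); rewrite /= -rnormE ltcR rdistC => h1.
have := h n _ (leq_maxr N n).
have := rdistD (u (maxn N n)) (u n) (lim (u @ \oo)).
lra.
Qed.

(** * Orthogonal projection in an inner product space *)

Section Projection.
Variables (R : realType) (H : lmodType R[i]) (q : {dot H for @Num.conj R[i]}).
Implicit Types (u v h : H) (G : set H).

Definition sqn u : R := complex.Re (q u u).

Lemma sqnE u : (sqn u)%:C = q u u.
Proof. by rewrite /sqn RRe_real// ger0_real// dnorm_ge0. Qed.

Lemma sqn_ge0 u : 0 <= sqn u.
Proof. by rewrite -ler0c sqnE dnorm_ge0. Qed.

Lemma sqnN u : sqn (- u) = sqn u.
Proof. by rewrite /sqn linearNr linearNl opprK. Qed.

Lemma parallelogram u v : sqn (u + v) + sqn (u - v) = 2 * sqn u + 2 * sqn v.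
Proof.
apply: complexI; rewrite !(rmorphD, rmorphM) /= !sqnE dnormD dnormB.
ring.
Qed.

(* Minimize |u - t h|^2 over the scalar t. *)
Lemma almost_orthogonal u h (d : R) :
  (forall t : R[i], sqn u <= sqn (u - t *: h) + d) ->
  `|q u h| ^+ 2 <= (d * sqn h)%:C.
Proof.
move=> hd; have [->|h0] := eqVneq h 0.
  by rewrite linear0r /sqn linear0r normr0 expr0n mulr0.
have b0 : 0 < q h h by rewrite dnorm_gt0.
rewrite rmorphM /= sqnE -ler_pdivrMr//.
have := hd (q u h / q h h); rewrite -lecR rmorphD /= !sqnE.
have [eqd eqdc] := conj_div_mul (q u h) b0.
rewrite dnormB dnormZ linearZr_LR /= eqdc eqd normf_div (gtr0_norm b0).
set z := `|q u h| ^+ 2; set b := q h h.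
have -> : q u u + (`|q u h| / b) ^+ 2 * b - (z / b + z / b) + d%:C
  = q u u + (d%:C - z / b) by rewrite /z; field; rewrite gt_eqF.
by rewrite lerDl subr_ge0.
Qed.

(** This is [almost_orthogonal] with the trivial defect [d = sqn u]. *)
Lemma cauchy_schwarz u h : `|q u h| ^+ 2 <= (sqn u * sqn h)%:C.
Proof. by apply: almost_orthogonal => t; rewrite lerDr sqn_ge0. Qed.

(** A minimizing sequence for the distance from [u] to [G] is Cauchy, and the residual at its limit
    is orthogonal to [G]. Completeness enters only as a hypothesis with rates, so that the result
    serves [X] and [X * X] alike; the factor 2 in the limit bound leaves room for two
    coordinates. *)
Lemma projection G :
  G 0 -> (forall (a : R[i]) u v, G u -> G v -> G (a *: u + v)) ->
  (forall w : nat -> H, (forall n, G (w n)) ->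
    (forall n m, (n <= m)%N -> sqn (w n - w m) <= (2 * 2^-1 ^+ n) ^+ 2) ->
    exists2 l, G l & forall n, sqn (w n - l) <= 2 * (2 * 2^-1 ^+ n) ^+ 2) ->
  forall u, exists2 v, G v & forall h, G h -> q (u - v) h = 0.
Proof.
move=> G0 GD Gc u.
pose S := [set sqn (u - v) | v in G].
have S_lb : has_lbound S by exists 0 => _ [v _ <-]; exact: sqn_ge0.
have S_inf : has_inf S by split=> //; exists (sqn (u - 0)), 0.
pose d := inf S.
have d_le v : G v -> d <= sqn (u - v).
  by move=> Gv; apply: ge_inf => //; exists v.
have /choice[w hw] n : exists v, G v /\ sqn (u - v) <= d + (2^-1 ^+ n) ^+ 2.
  have e0 : 0 < (2^-1 ^+ n) ^+ 2 :> R by rewrite exprn_gt0// half_exp_gt0.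
  have [_ [v Gv <-] /ltW hv] := inf_adherent e0 S_inf; by exists v.
have Gw n := (hw n).1; have w_le n := (hw n).2.
have [n m nm|l Gl hl] := Gc w Gw.
  (* The midpoint of [w n] and [w m] lies in [G], so its squared distance to [u] is at least [d];
     the parallelogram law then bounds [sqn (w n - w m)] by four times [(2^-1 ^+ n) ^+ 2]. *)
  have Gmid : G (2^-1 *: (w n + w m)).
    rewrite -[_ *: _]addr0; apply: (GD) => //.
    by rewrite -[w n]scale1r; apply: (GD).
  have := parallelogram (u - w n) (u - w m).
  have -> : u - w n + (u - w m) = 2%:C *: (u - 2^-1 *: (w n + w m)).
    rewrite scalerBr scalerA [2%:C](rmorph_nat _ 2) divff ?pnatr_eq0// scale1r.
    by rewrite scaler_nat mulr2n opprD addrACA.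
  have -> : sqn (2%:C *: (u - 2^-1 *: (w n + w m))) =
      4 * sqn (u - 2^-1 *: (w n + w m)).
    apply: complexI; rewrite rmorphM /= !sqnE dnormZ.
    rewrite normc_def /= expr0n addr0 sqrtr_sqr ger0_norm//.
    by rewrite -rmorphXn /= -natrX.
  have -> : sqn (u - w n - (u - w m)) = sqn (w n - w m).
    by rewrite -[RHS]sqnN !opprB [u - w n + _]addrC addrA subrK.
  have := d_le _ Gmid; have := w_le n; have := w_le m.
  have : (2^-1 ^+ m) ^+ 2 <= (2^-1 ^+ n) ^+ 2 :> R.
    rewrite ler_sqr ?nnegrE ?(ltW (half_exp_gt0 _ _))//.
    by apply: ler_wiXn2l => //; lra.
  rewrite exprMn; lra.
exists l => // h Gh.
have orth n : `|q (u - w n) h| ^+ 2 <= ((2^-1 ^+ n) ^+ 2 * sqn h)%:C.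
  apply: almost_orthogonal => t; apply: (le_trans (w_le n)); rewrite lerD2r.
  by rewrite -addrA -opprD [w n + _]addrC d_le//; apply: (GD).
pose c := complex.Re (`|q (u - l) h| ^+ 2).
have cE : c%:C = `|q (u - l) h| ^+ 2.
  by rewrite /c RRe_real// ger0_real// exprn_ge0.
apply/eqP; rewrite -normr_eq0 -sqrf_eq0 -cE; apply/eqP; congr (_%:C).
(* Split [u - l] at [w n]: the near-orthogonality of [u - w n] contributes 2 and Cauchy-Schwarz for
   [w n - l] contributes 2 * 2 * 4 = 16, in units of [(2^-1 ^+ n) ^+ 2 * sqn h]. *)
apply: (@le_geometric_eq0 _ (18 * sqn h)) => [|n].
  by rewrite -ler0c cE exprn_ge0.
have g1 : (2^-1 ^+ n) ^+ 2 <= 2^-1 ^+ n :> R.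
  have := half_exp_gt0 R n.
  have : 2^-1 ^+ n <= 1 :> R by apply: exprn_ile1; lra.
  nra.
apply: (@le_trans _ _ (2 * ((2^-1 ^+ n) ^+ 2 * sqn h) +
    2 * (2 * (2 * 2^-1 ^+ n) ^+ 2 * sqn h))); last first.
  rewrite exprMn; have := sqn_ge0 h; nra.
have two : 2%:C = 2 :> R[i] by rewrite rmorphD.
set a1 := _ * sqn h; set a2 := _ * sqn h.
rewrite -lecR cE rmorphD /= [(2 * a1)%:C]rmorphM [(2 * a2)%:C]rmorphM /= two.
rewrite -[u](subrK (w n)) -addrA linearDl /=.
apply: (le_trans (sqr_normD_le _ _)); rewrite lerD// ler_pM2l//.
apply: (le_trans (cauchy_schwarz _ _)); rewrite lecR ler_wpM2r//.
exact: sqn_ge0.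
Qed.

End Projection.

(** * The inner product on a product of two spaces *)

Section ProductDot.
Variables (R : realType) (X Y : lmodType R[i]).
Variables (p : {dot X for @Num.conj R[i]}) (q : {dot Y for @Num.conj R[i]}).

Definition prod_dot (u v : X * Y) : R[i] := p u.1 v.1 + q u.2 v.2.

Let prod_dotl v : GRing.linear_for *%R (prod_dot ^~ v).
Proof. by move=> a u w; rewrite /prod_dot /= !linearPl /=; ring. Qed.

Let prod_dotr u : GRing.linear_for (Num.conj \; *%R) (prod_dot u).
Proof. by move=> a v w; rewrite /prod_dot /= !linearPr /=; ring. Qed.

HB.instance Definition _ :=
  bilinear_isBilinear.Build R[i] (X * Y)%type (X * Y)%type R[i] _ _ prod_dot
    (prod_dotl, prod_dotr).

Let prod_dotC u v : prod_dot u v = (-1) ^+ false * Num.conj (prod_dot v u).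
Proof. by rewrite /prod_dot rmorphD mul1r /= (hermC p) (hermC q) !mul1r. Qed.

HB.instance Definition _ :=
  isHermitianSesquilinear.Build R[i] (X * Y)%type false _ prod_dot prod_dotC.

Let prod_dot_gt0 u : u != 0 -> 0 < prod_dot u u.
Proof.
move=> u0; rewrite lt_def addr_ge0 ?dnorm_ge0// andbT.
rewrite paddr_eq0 ?dnorm_ge0// !dnorm_eq0; apply: contra u0.
by case: u => x y /= /andP[/eqP -> /eqP ->].
Qed.

HB.instance Definition _ :=
  isDotProduct.Build R[i] (X * Y)%type prod_dot prod_dot_gt0.

End ProductDot.

(** * Subspaces admitting an orthogonal projection *)

Section Complemented.
Variables (R : realType) (H : lmodType R[i]) (q : {dot H for @Num.conj R[i]}).
Implicit Types (u v : H) (V N : set H).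

Definition linear_subspace V : Prop :=
  V 0 /\ forall (a : R[i]) u v, V u -> V v -> V (a *: u + v).

(** This replaces closedness: it makes sense without a norm on [H] and passes to finite extensions
    by algebra alone. *)
Definition complemented V : Prop :=
  forall u, exists2 v, V v & forall h, V h -> q (u - v) h = 0.

Definition add_line V v : set H :=
  [set u | exists2 x, V x & exists a : R[i], u = x + a *: v].

Lemma subspaceZ V a u : linear_subspace V -> V u -> V (a *: u).
Proof. by move=> [V0 VD] Vu; rewrite -[_ *: _]addr0; apply: VD. Qed.

Lemma subspaceD V u v : linear_subspace V -> V u -> V v -> V (u + v).
Proof. by move=> [V0 VD] Vu Vv; rewrite -[u]scale1r; apply: VD. Qed.

Lemma subspaceB V u v : linear_subspace V -> V u -> V v -> V (u - v).
Proof.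
by move=> sV Vu Vv; apply: subspaceD => //; rewrite -scaleN1r; apply: subspaceZ.
Qed.

Lemma subspace_add_line V v :
  linear_subspace V -> linear_subspace (add_line V v).
Proof.
move=> [V0 VD]; split; first by exists 0 => //; exists 0; rewrite scale0r addr0.
move=> a _ _ [x Vx [b ->]] [y Vy [c ->]].
exists (a *: x + y); first exact: VD.
by exists (a * b + c); rewrite scalerDr scalerA scalerDl addrACA.
Qed.

(** A Gram-Schmidt step: replace [v] by its component [v - x] orthogonal to [V], and add the
    projection onto that line to the projection onto [V]. *)
Lemma complemented_add_line V v :
  linear_subspace V -> complemented V -> complemented (add_line V v).
Proof.
move=> sV cV u; have [x Vx vx] := cV v; have [y Vy uy] := cV u.
pose t := q (u - y) (v - x) / q (v - x) (v - x).
exists (y + t *: (v - x)).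
  exists (y - t *: x); first by apply: subspaceB => //; apply: subspaceZ.
  by exists t; rewrite scalerBr addrA addrAC.
have h1 z : V z -> q (u - (y + t *: (v - x))) z = 0.
  move=> Vz; rewrite opprD addrA linearBl linearZl_LR /=.
  by rewrite uy// vx// mulr0 subr0.
have h2 : q (u - (y + t *: (v - x))) (v - x) = 0.
  rewrite opprD addrA linearBl linearZl_LR /= /t.
  have [->|vx0] := eqVneq (v - x) 0; first by rewrite !linear0r subrr.
  by rewrite divfK ?subrr// dnorm_eq0.
have h3 : q (u - (y + t *: (v - x))) v = 0.
  by rewrite -[X in q _ X](subrK x v) linearDr /= h2 h1// addr0.
by move=> _ [z Vz [a ->]]; rewrite linearDr linearZr_LR /= h1// h3 mulr0 addr0.
Qed.

(* Induction on n: if some vector of N has a nonzero coefficient at e_0, adding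
   it to V removes e_0 from the spanning set; otherwise e_0 is not needed. *)
Lemma complemented_finite_ext n (e : 'I_n -> H) V N :
  linear_subspace V -> linear_subspace N -> V `<=` N -> complemented V ->
  (forall u, N u -> exists2 v, V v &
     exists c : 'I_n -> R[i], u = v + \sum_(i < n) c i *: e i) ->
  complemented N.
Proof.
elim: n e V => [|n IH] e V sV sN VN cV NV.
  have -> // : N = V.
  apply/seteqP; split=> // u /NV[v Vv [c ->]].
  by rewrite big_ord0 addr0.
have [[v [Nv [x [c [Vx c0 vE]]]]]|hno] := pselect (exists v, N v /\
    exists x (c : 'I_n.+1 -> R[i]),
    [/\ V x, c ord0 != 0 & v = x + \sum_(i < n.+1) c i *: e i]).
  apply: (IH (e \o lift ord0) (add_line V v)) => //.
  - exact: subspace_add_line.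
  - move=> _ [y Vy [a ->]]; apply: subspaceD => //; first exact: VN.
    exact: subspaceZ.
  - exact: complemented_add_line.
  (* With this [t], the vector [u - t *: v] has coefficient 0 at [e ord0]. *)
  move=> u /NV[y Vy [d ->]]; pose t := d ord0 / c ord0.
  exists (y - t *: x + t *: v).
    exists (y - t *: x); last by exists t.
    by apply: subspaceB => //; apply: subspaceZ.
  exists (fun i => d (lift ord0 i) - t * c (lift ord0 i)).
  have -> : \sum_(i < n) (d (lift ord0 i) - t * c (lift ord0 i)) *:
        (e \o lift ord0) i = \sum_(i < n) d (lift ord0 i) *: e (lift ord0 i) -
      t *: \sum_(i < n) c (lift ord0 i) *: e (lift ord0 i).
    rewrite scaler_sumr -sumrB; apply: eq_bigr => i _.
    by rewrite scalerBl scalerA.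
  rewrite vE !big_ord_recl !scalerDr scalerA divfK//.
  set S := \sum_(i < n) _; set T := t *: \sum_(i < n) _.
  by rewrite [_ + (t *: x + _)]addrA subrK !addrA [_ + T + S]addrAC addrK.
apply: (IH (e \o lift ord0) V) => // u Nu; have [y Vy [d uE]] := NV _ Nu.
exists y => //; exists (d \o lift ord0); rewrite uE big_ord_recl.
have [->|d0] := eqVneq (d ord0) 0; first by rewrite scale0r add0r.
by case: hno; exists u; split=> //; exists y, d.
Qed.

End Complemented.

(** * Closed subspaces and adjoints in a Hilbert space *)

Section Hilbert.
Variables (R : realType) (X : completeNormedModType R[i]).
Variables (ip : {dot X for @Num.conj R[i]}) (hX : hilbert_dot ip).

Lemma sqn_rnorm x : sqn ip x = rnorm x ^+ 2.
Proof. by apply: complexI; rewrite sqnE rmorphXn /= rnormE hX. Qed.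

Lemma dot_le x y : `|ip x y| <= (rnorm x * rnorm y)%:C.
Proof.
rewrite -ler_sqr ?nnegrE ?normr_ge0 ?ler0c ?mulr_ge0 ?rnorm_ge0//.
apply: (le_trans (cauchy_schwarz _ _ _)).
by rewrite !sqn_rnorm -exprMn rmorphXn.
Qed.

Let le_half_exp (x : R) n : x ^+ 2 <= (2 * 2^-1 ^+ n) ^+ 2 -> 0 <= x ->
  x <= 2 * 2^-1 ^+ n.
Proof.
move=> h x0; rewrite -ler_sqr ?nnegrE// mulr_ge0// exprn_ge0// invr_ge0.
Qed.

Lemma closed_complemented (V : set X) :
  linear_subspace V -> closed V -> complemented ip V.
Proof.
move=> [V0 VD] Vc; apply: projection => // w Vw hw.
have [n m nm|l hl] := @rnorm_complete _ _ w 2.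
  by apply: le_half_exp; rewrite -?sqn_rnorm ?rnorm_ge0 ?hw.
exists l; last first.
  move=> n; have := hl n; have := rnorm_ge0 (w n - l); rewrite sqn_rnorm.
  nra.
apply: (closed_cvg V Vc _ _ (cvg_rnorm hl)); exists 0%N => // n _; exact: Vw.
Qed.

(** Limits in [X * X] are taken coordinatewise, each coordinate being dominated by the norm of
    [prod_dot]. *)
Lemma closed_complemented_prod (G : set (X * X)) :
  linear_subspace G -> closed G -> complemented (prod_dot ip ip) G.
Proof.
move=> [G0 GD] Gc; apply: projection => // w Gw hw.
have sq p : sqn (prod_dot ip ip) p = rnorm p.1 ^+ 2 + rnorm p.2 ^+ 2.
  by apply: complexI; rewrite sqnE rmorphD /= !rmorphXn /= !rnormE !hX.
have [n m nm|l hl] := @rnorm_complete _ _ (fun n => (w n).1) 2.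
  apply: le_half_exp; rewrite ?rnorm_ge0//.
  by have := hw n m nm; rewrite sq; apply: le_trans; rewrite lerDl sqr_ge0.
have [n m nm|k hk] := @rnorm_complete _ _ (fun n => (w n).2) 2.
  apply: le_half_exp; rewrite ?rnorm_ge0//.
  by have := hw n m nm; rewrite sq; apply: le_trans; rewrite lerDr sqr_ge0.
have cw : w @ \oo --> (l, k).
  rewrite (_ : w = fun n => ((w n).1, (w n).2)); last first.
    by apply/funext => n; case: (w n).
  exact: cvg_pair (cvg_rnorm hl) (cvg_rnorm hk).
have Glk : G (l, k).
  by apply: (closed_cvg G Gc _ _ cw); exists 0%N => // n _; exact: Gw.
exists (l, k) => // n; rewrite sq /=.
have := hl n; have := rnorm_ge0 ((w n).1 - l).
have := hk n; have := rnorm_ge0 ((w n).2 - k).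
nra.
Qed.

(** If [y] were nonzero, some [x] in the domain would satisfy [|y - x| < |y|], and then
    [|y|^2 = ip (y - x) y] would be less than [|y|^2]. *)
Lemma dense_orthogonal (T : operator X) y : densely_defined T ->
  (forall x, dom T x -> ip x y = 0) -> y = 0.
Proof.
move=> Td h; apply/eqP; apply/negPn/negP => y0.
have ny : 0 < `|y| by rewrite normr_gt0.
have : closure (dom T) y by rewrite Td.
move=> /(_ _ (nbhsx_ballx y `|y| ny))[x [Tx]].
rewrite -ball_normE /= => xy.
have : ip y y = ip (y - x) y by rewrite linearBl /= (h x Tx) subr0.
move/(congr1 Num.norm); rewrite -hX normrX normr_id => e.
have := dot_le (y - x) y; rewrite -e rmorphM /= !rnormE expr2.
by rewrite ler_pM2r// lt_geF.
Qed.

(** [adjoint] selects its value by [xget]; density of the domain makes every admissible value the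
    selected one. *)
Lemma adjointE (T : operator X) y z : densely_defined T ->
  adjoint_values ip T y z -> dom (adjoint ip T) y /\ adjoint ip T y = z.
Proof.
move=> Td yz; split; first by exists z.
apply/eqP; rewrite -subr_eq0; apply/eqP; apply: (dense_orthogonal Td) => x Tx.
rewrite linearBr /= -yz//.
have hx : adjoint_values ip T y (adjoint ip T y).
  by apply: (@xgetPex _ 0); exists z.
by rewrite -hx// subrr.
Qed.

Lemma adjointP (T : operator X) y : dom (adjoint ip T) y ->
  forall x, dom T x -> ip (T x) y = ip x (adjoint ip T y).
Proof. by move=> hy; exact: (@xgetPex _ 0 _ hy). Qed.

Lemma dotC x y : ip x y = Num.conj (ip y x).
Proof. by rewrite (hermC ip) mul1r. Qed.

(* Project (y, 0) onto the closed graph of T: the complementary component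
   (y - a, - T a) lies in the rotated graph of the adjoint. *)
Lemma orthogonal_adjoint_range (T : operator X) y :
  linear_op T -> closed_op T -> densely_defined T ->
  (forall x, dom (adjoint ip T) x -> ip (adjoint ip T x) y = 0) ->
  dom T y /\ T y = 0.
Proof.
move=> [T0 TD] Tc Td hy.
have sG : linear_subspace [set p : X * X | dom T p.1 /\ T p.1 = p.2].
  split=> [|a [x x'] [z z'] /= [Tx <-] [Tz <-]]; last exact: TD.
  split=> //=; have [_] := TD (-1) 0 0 T0 T0.
  by rewrite scaleN1r oppr0 addr0 scaleN1r addNr.
have [[a b] [/= Ta ab] orth] := closed_complemented_prod sG Tc (y, 0).
pose u := y - a; pose v := - b.
have uv h : dom T h -> ip u h + ip v (T h) = 0.
  move=> Th; have := orth (h, T h) (conj Th erefl).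
  by rewrite /prod_dot /= sub0r.
(* Orthogonality of [(u, v)] to the graph of [T] says exactly that the adjoint sends [v] to
   [- u]. *)
have /(adjointE Td)[vdom vE] : adjoint_values ip T v (- u).
  move=> x Tx; have e : ip x (- u) = - ip x u by rewrite linearNr.
  rewrite e dotC [ip x u]dotC; apply/eqP.
  by rewrite -subr_eq0 opprK -rmorphD addrC /= uv// rmorph0.
have uy : ip u y = 0.
  by have := hy _ vdom; rewrite vE linearNl => /eqP; rewrite oppr_eq0 => /eqP.
(* As [u] is orthogonal to [y], this sum equals [- (ip u a + ip v (T a))], which vanishes by
   [uv]. *)
have : ip u u + ip v v = 0.
  by rewrite {2}/u {2}/v -ab linearBr linearNr /= uy sub0r -opprD uv// oppr0.
move/eqP; rewrite paddr_eq0 ?dnorm_ge0// !dnorm_eq0 => /andP[/eqP u0 /eqP v0].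
have ya : y = a by apply/eqP; rewrite -subr_eq0 -/u u0.
by rewrite ya ab; split=> //; apply/eqP; rewrite -oppr_eq0 -/v v0.
Qed.

End Hilbert.

(** * Bounded operators: operator norm, almost openness, perturbation *)

Section OperatorNorm.
Variables (R : realType) (W X : completeNormedModType R[i]).
Implicit Types f : W -> X.

Lemma bounded_op_rnorm f : bounded_op f ->
  exists2 M : R, 0 <= M & forall w, rnorm (f w) <= M * rnorm w.
Proof.
(* The given bound is a complex number; its modulus is a nonnegative real bound. *)
move=> [M hM]; exists (complex.Re `|M|) => [|w].
  by rewrite -ler0c RRe_real ?normr_real.
rewrite -lecR rmorphM /= !rnormE ?RRe_real ?normr_real//.
have h := hM w; have h0 : 0 <= M * `|w| by apply: le_trans h.
by apply: (le_trans h); rewrite -(ger0_norm h0) normrM normr_id.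
Qed.

(** Boundedness makes the supremum in [op_norm] genuine; then rescale [w] to norm 1. Only
    homogeneity is asked of [f], so that pointwise differences of linear maps qualify. *)
Lemma le_op_norm f (w : W) : bounded_op f ->
  (forall (a : R) w, 0 <= a -> f (a%:C *: w) = a%:C *: f w) ->
  rnorm (f w) <= op_norm f * rnorm w.
Proof.
move=> /bounded_op_rnorm[M M0 hM] fZ.
have ub : has_ubound [set rnorm (f w) | w in [set w | `|w| <= 1]].
  exists M => _ [v /= v1 <-]; apply: (le_trans (hM v)).
  by rewrite ler_piMr// -lecR rnormE.
have [->|w0] := eqVneq w 0.
  by have := hM 0; rewrite rnorm0 !mulr0.
have nw : 0 < rnorm w by rewrite -ltcR rnormE normr_gt0.
rewrite -ler_pdivrMr// mulrC -rnormZ ?invr_ge0 ?rnorm_ge0//.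
rewrite -fZ ?invr_ge0 ?rnorm_ge0//.
apply: ub_le_sup => //; exists ((rnorm w)^-1%:C *: w) => //=.
by rewrite -rnormE rnormZ ?invr_ge0 ?rnorm_ge0// mulVf ?gt_eqF.
Qed.

End OperatorNorm.

(* Baire's theorem for the closures of the images of the balls of radius n.
   The nested balls p n are constructed by hand, since mathcomp-analysis has
   Baire's theorem only for normed spaces over a realType, not over R[i]. *)
Lemma surjective_almost_open (R : realType) (W : normedModType R[i])
    (X : completeNormedModType R[i]) (T : {linear W -> X}) :
  range T = setT ->
  exists2 C : R, 0 <= C & forall x (e : R), 0 < e ->
    exists2 w, rnorm w <= C * rnorm x & rnorm (x - T w) < e.
Proof.
move=> Tsurj.
have [[x [r [n [r0 hball]]]]|hno] := pselect (exists x (r : R) n, 0 < r /\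
    forall y s, 0 < s -> rnorm (x - y) + s <= r -> s <= r / 2 ->
    exists2 w, rnorm w <= n%:R & rnorm (y - T w) <= s).
  (* A vector [v] is scaled by [k^-1] to length [r / 2]; subtracting approximate preimages of [x]
     and [x + k^-1 v], both of norm at most [n], costs [k * 2n], which is [4n / r * |v|]. *)
  exists (4 * n%:R / r) => [|v e e0].
    by rewrite divr_ge0 ?mulr_ge0 ?ler0n ?(ltW r0).
  have [->|v0] := eqVneq v 0.
    exists 0; [by rewrite !rnorm0 mulr0|by rewrite linear0 subr0 rnorm0].
  have nv : 0 < rnorm v by rewrite -ltcR rnormE normr_gt0.
  pose k := 2 * rnorm v / r.
  have k0 : 0 < k by rewrite !(mulr_gt0, divr_gt0)// invr_gt0.
  (* The first bound keeps both balls inside the given one; the second makes the rescaled error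
     [k * 2s] at most [e / 2]. *)
  pose s := Num.min (r / 2) (e / (4 * k)).
  have s0 : 0 < s by rewrite lt_min !divr_gt0// mulr_gt0.
  have sr : s <= r / 2 by rewrite ge_min lexx.
  have se : s <= e / (4 * k) by rewrite ge_min lexx orbT.
  have [|//|w1 w1n w1s] := hball x s s0; first by rewrite subrr rnorm0; lra.
  have [|//|w2 w2n w2s] := hball (x + k^-1%:C *: v) s s0.
    rewrite opprD addrA subrr sub0r rnormN rnormZ ?invr_ge0 ?(ltW k0)//.
    have -> : k^-1 * rnorm v = r / 2 by rewrite /k; field; rewrite !gt_eqF.
    lra.
  exists (k%:C *: (w2 - w1)).
    rewrite rnormZ ?(ltW k0)//.
    have -> : 4 * n%:R / r * rnorm v = k * (2 * n%:R).
      by rewrite /k; field; rewrite gt_eqF.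
    rewrite ler_pM2l//; have := rnormD w2 (- w1); rewrite rnormN; lra.
  have -> : v - T (k%:C *: (w2 - w1)) =
      k%:C *: ((x + k^-1%:C *: v - T w2) - (x - T w1)).
    rewrite linearZ linearB /= -[v in LHS]scale1r.
    have <- : k%:C * k^-1%:C = 1 :> R[i] by rewrite -rmorphM /= divff ?gt_eqF.
    rewrite -scalerA -scalerBr; congr (_ *: _).
    by rewrite !opprB [RHS]addrC !addrA subrK [_ + T w1]addrC.
  rewrite rnormZ ?(ltW k0)//.
  have := rnormD (x + k^-1%:C *: v - T w2) (- (x - T w1)); rewrite rnormN => h.
  apply: (@le_lt_trans _ _ (k * (2 * s))); first by rewrite ler_pM2l//; lra.
  apply: (@le_lt_trans _ _ (k * (2 * (e / (4 * k))))).
    by rewrite ler_pM2l//; lra.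
  have -> : k * (2 * (e / (4 * k))) = e / 2 by field; rewrite gt_eqF.
  lra.
exfalso.
(* Otherwise each ball contains one of at most half the radius that misses the image of the ball of
   radius [n]. *)
have /choice[F hF] (p : X * R * nat) : exists q : X * R, 0 < p.1.2 ->
    [/\ 0 < q.2, rnorm (p.1.1 - q.1) + q.2 <= p.1.2, q.2 <= p.1.2 / 2 &
      forall w, rnorm w <= p.2%:R -> q.2 < rnorm (q.1 - T w)].
  case: p => [[x r] n] /=; apply/not_existsP => h; apply: hno.
  exists x, r, n; have [r0|r0] := ltP 0 r; last first.
    by have := h (x, r); rewrite ltNge r0 => /(_ _)[].
  split=> // y s s0 ys sr; apply: contrapT => hw.
  apply: (h (y, s)) => _; split=> //=.
  by move=> w wn; rewrite ltNge; apply/negP => ws; apply: hw; exists w.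
pose p := fix p n := if n is m.+1 then F (p m, m) else (0, 1).
have p0 n : 0 < (p n).2.
  by elim: n => [|n IH] /=; [exact: ltr01 | have [] := hF (p n, n) IH].
have step n := hF (p n, n) (p0 n).
have rg n : (p n).2 <= 1 * 2^-1 ^+ n.
  elim: n => [|n IH]; first by rewrite expr0 mulr1.
  have [_ _ h _] := step n; apply: (le_trans h) => /=.
  rewrite exprSr; lra.
have nest n m : (n <= m)%N -> rnorm ((p n).1 - (p m).1) + (p m).2 <= (p n).2.
  move=> /subnK <-; elim: (m - n)%N => [|d IH].
    by rewrite subrr rnorm0 add0r.
  have [_ h _ _] := step (d + n)%N.
  have := rdistD (p (d + n)%N).1 (p n).1 (p (d.+1 + n)%N).1.
  rewrite /= in h *; lra.
have [n m nm|l hl] := @rnorm_complete _ _ (fun n => (p n).1) 1.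
  by have := nest n m nm; have := rg n; have := p0 m; lra.
have hl' n : rnorm ((p n).1 - l) <= (p n).2.
  apply/ler_addgt0Pr => e e0; have [N hN] := geometric_small 1 e0.
  have h1 := hN _ (leq_maxl N n); have h2 := nest n _ (leq_maxr N n).
  have := rdistD (p (maxn N n)).1 (p n).1 l.
  have := hl (maxn N n); have := p0 (maxn N n); lra.
have [w _ wl] : range T l by rewrite Tsurj.
have [n wn] : exists n, rnorm w <= n%:R.
  by exists (Num.bound (rnorm w)); apply/ltW/archi_boundP/rnorm_ge0.
(* The ball [p n.+1] was chosen to miss images of vectors of norm at most [n], yet it contains
   [l = T w]. *)
have [_ _ _ /(_ w wn)] := step n.
by rewrite wl ltNge; have /= -> := hl' n.+1.
Qed.

Lemma perturbed_surjective (R : realType) (W X : completeNormedModType R[i])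
    (T : {linear W -> X}) (C : R) :
  bounded_op T -> 0 <= C ->
  (forall x, exists2 w, rnorm w <= C * rnorm x &
    rnorm (x - T w) <= 2^-1 * rnorm x) ->
  range T = setT.
Proof.
move=> /bounded_op_rnorm[M M0 hM] C0 hT.
have /choice[f fP] x : exists w, rnorm w <= C * rnorm x /\
    rnorm (x - T w) <= 2^-1 * rnorm x.
  by have [w wC wT] := hT x; exists w.
have fC x := (fP x).1; have fT x := (fP x).2.
apply/seteqP; split=> // x _.
(* Each iterate adds an approximate solution for the current residual, which is thereby halved. *)
pose u := fix u n := if n is m.+1 then u m + f (x - T (u m)) else 0.
have res n : rnorm (x - T (u n)) <= rnorm x * 2^-1 ^+ n.
  elim: n => [|n IH] /=; first by rewrite linear0 subr0 expr0 mulr1.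
  rewrite linearD opprD addrA; apply: (le_trans (fT _)).
  rewrite exprSr; lra.
pose K := 2 * C * rnorm x.
have K0 : 0 <= K by rewrite !mulr_ge0// rnorm_ge0.
(* The increment bound [C * rnorm x * 2^-1 ^+ k] equals [K] times the difference of consecutive
   powers, so the sum telescopes. *)
have inc n m : (n <= m)%N -> rnorm (u n - u m) <= K * (2^-1 ^+ n - 2^-1 ^+ m).
  move=> /subnK <-; elim: (m - n)%N => [|d IH].
    by rewrite !subrr rnorm0 mulr0.
  apply: (le_trans (rdistD (u (d + n)%N) _ _)).
  have -> : u (d + n)%N - u (d.+1 + n)%N = - f (x - T (u (d + n)%N)).
    by rewrite /= opprD addrA subrr sub0r.
  rewrite rnormN addSn exprSr.
  have := fC (x - T (u (d + n)%N)).
  have : C * rnorm (x - T (u (d + n)%N)) <= C * (rnorm x * 2^-1 ^+ (d + n)).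
    by rewrite ler_wpM2l.
  rewrite /K in IH *; lra.
have [n m nm|l hl] := @rnorm_complete _ _ u K.
  apply: (le_trans (inc n m nm)); rewrite ler_wpM2l//.
  have := half_exp_gt0 R m; lra.
exists l => //; apply/eqP; rewrite eq_sym -subr_eq0.
apply/eqP; apply: rnorm_eq0.
apply: (@le_geometric_eq0 _ (rnorm x + M * K)) => [|n]; first exact: rnorm_ge0.
apply: (le_trans (rdistD (T (u n)) _ _)).
have := res n; have := hM (u n - l); rewrite linearB /=.
have : M * rnorm (u n - l) <= M * (K * 2^-1 ^+ n) by rewrite ler_wpM2l ?hl.
lra.
Qed.

Lemma subspace_range (R : realType) (W X : lmodType R[i])
    (T : {linear W -> X}) :
  linear_subspace (range T).
Proof.
split; first by exists 0 => //; rewrite linear0.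
move=> a _ _ [u _ <-] [v _ <-].
by exists (a *: u + v) => //; rewrite linearP.
Qed.

(** * Surjectivity of the adjoint restricted to [D_W] *)

Section MaximalDomain.
Variables (R : realType) (X W : completeNormedModType R[i]).
Variables (ip : {dot X for @Num.conj R[i]}) (hX : hilbert_dot ip).
Variables (A : operator X) (j : {linear W -> X}).
Hypotheses (A_lin : linear_op A) (A_closed : closed_op A).
Hypotheses (A_dense : densely_defined A) (A_sym : symmetric_op ip A).
Hypothesis hDW : domain_setting ip A j.

Lemma norm_le_graph_norm (T : operator X) x : `|T x| <= graph_norm T x.
Proof.
rewrite /graph_norm -[leLHS]sqrCK// ler_sqrtC ?nnegrE ?addr_ge0 ?exprn_ge0//.
by rewrite lerDr exprn_ge0.
Qed.

Lemma orthogonal_adjoint_on_DW y :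
  (forall w, ip (adjoint ip A (j w)) y = 0) -> dom A y /\ A y = 0.
Proof.
move=> hy; apply: (orthogonal_adjoint_range hX) => // x Ax.
pose c := complex.Re `|ip (adjoint ip A x) y|.
have cE : c%:C = `|ip (adjoint ip A x) y| by rewrite RRe_real ?normr_real.
apply/eqP; rewrite -normr_eq0 -cE; apply/eqP; congr (_%:C).
apply: (@le_geometric_eq0 _ (rnorm y)) => [|n]; first by rewrite -ler0c cE.
have e0 := half_exp_gt0 R n; rewrite mulrC.
have [|w hw] := setting_dense hDW Ax (e := (2^-1 ^+ n)%:C).
  by rewrite ltcR.
(* Additivity of the adjoint, again by uniqueness of its value. *)
have [_ E] : dom (adjoint ip A) (x - j w) /\
    adjoint ip A (x - j w) = adjoint ip A x - adjoint ip A (j w).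
  apply: (adjointE hX A_dense) => h Ah; rewrite !linearBr /= !adjointP//.
  by apply: (setting_DW_sub_Dmax hDW); exists w.
have : `|ip (adjoint ip A x) y| <=
    (rnorm (adjoint ip A (x - j w)) * rnorm y)%:C.
  rewrite E -[ip _ _]subr0 -(hy w) -linearBl; exact: dot_le.
rewrite -cE lecR => h; apply: (le_trans h).
rewrite ler_wpM2r ?rnorm_ge0// -lecR rnormE.
exact/(le_trans (norm_le_graph_norm _ _))/ltW.
Qed.

Lemma adjoint_on_DW_surjective (A0 : {linear W -> X}) :
  (forall w, A0 w = adjoint ip A (j w)) -> weak_inner_UCP j (dom A) A0 ->
  range A0 = setT.
Proof.
move=> A0E ucp.
have [B [[B_lin B_dense [sB1 sB2] [sB3 sB4]] [B_closed _ BR_closed BR_codim]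
  [AB1 AB2] BW]] := setting_selfadjoint hDW.
have B_sym x y : dom B x -> dom B y -> ip (B x) y = ip x (B y).
  by move=> Bx By; rewrite -(sB4 y By) (adjointP (sB3 _ By)).
have sV : linear_subspace (B @` dom B).
  have [B0 BD] := B_lin; split=> [|a _ _ [u Bu <-] [v Bv <-]].
    exists 0 => //; have [_] := BD (-1) 0 0 B0 B0.
    by rewrite scaleN1r oppr0 addr0 scaleN1r addNr.
  by have [Buv <-] := BD a u v Bu Bv; exists (a *: u + v).
have VN : B @` dom B `<=` range A0.
  move=> _ [x Bx <-]; have [w _ wx] := BW x Bx; exists w => //.
  (* [B] is symmetric and extends [A], so the adjoint of [A] agrees with [B] on [dom B]. *)
  rewrite A0E wx; apply: (adjointE hX A_dense _).2 => h Ah.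
  by rewrite -AB2// B_sym//; apply: AB1.
have [n [e hcodim]] := BR_codim.
have cN : complemented ip (range A0).
  apply: (complemented_finite_ext sV (subspace_range A0) VN _ (e := e)) => //.
  exact: closed_complemented.
(* With [v] the projection of [x], the difference [x - v] lies in the kernel of [A], where UCP
   forces it to be 0. *)
apply/seteqP; split=> // x _; have [v Nv vx] := cN x.
have [|Ay Ay0] := @orthogonal_adjoint_on_DW (x - v).
  by move=> w; rewrite -A0E dotC vx ?rmorph0//; exists w.
have [w _ wE] := setting_Dm_sub_DW hDW Ay.
suff w0 : w = 0.
  by move: wE; rewrite w0 linear0 => /esym/eqP; rewrite subr_eq0 => /eqP ->.
have : [set w | dom A (j w) /\ A0 w = 0] w.
  split; rewrite ?A0E wE//; apply: (adjointE hX A_dense _).2 => h Ah.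
  by rewrite A_sym// Ay0.
by rewrite ucp.
Qed.

End MaximalDomain.

(** * Surjectivity along the curve *)

Section Curve.
Variables (R : realType) (W X : completeNormedModType R[i]).
Variable AW : R -> {linear W -> X}.

Lemma bounded_opB (f g : W -> X) :
  bounded_op f -> bounded_op g -> bounded_op (fun w => f w - g w).
Proof.
move=> [M hM] [N hN]; exists (M + N) => w.
by rewrite mulrDl; apply: (le_trans (ler_normB _ _)); rewrite lerD.
Qed.

Lemma surjective_near0 :
  (forall s : R, 0 <= s <= 1 -> bounded_op (AW s)) ->
  continuous_curve AW -> range (AW 0) = setT ->
  exists2 s0 : R, 0 < s0 & forall s : R, 0 <= s <= 1 -> s < s0 ->
    range (AW s) = setT.
Proof.
move=> AWb AWc surj0.
have I0 : 0 <= (0 : R) <= 1 by rewrite lexx ler01.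
have [C C0 hC] := surjective_almost_open surj0.
(* For [|w| <= C |x|] this makes the perturbation at most [|x| / 4]; solving for [AW 0] up to
   [|x| / 4] leaves a total error of [|x| / 2]. *)
have d0 : 0 < 4^-1 / (C + 1) by rewrite divr_gt0// ltr_wpDl.
have /cvgrPdist_lt/(_ _ d0) := AWc 0 I0.
rewrite near_withinE => /nbhs_ballP[s0 /= s00 hs].
exists s0 => // s s01 ss0.
have {hs} hs : op_norm (fun w => AW s w - AW 0 w) < 4^-1 / (C + 1).
  have := hs s; rewrite /ball /= sub0r !normrN ger0_norm.
    2: by case/andP: s01.
  rewrite in_itv /= => /(_ ss0 s01); apply: le_lt_trans.
  by rewrite sub0r normrN ler_norm.
have hd w : rnorm (AW s w - AW 0 w) <= 4^-1 / (C + 1) * rnorm w.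
  apply: (le_trans (le_op_norm _ (bounded_opB (AWb s s01) (AWb 0 I0)) _)).
    by move=> a v _; rewrite scalerBr -!linearZ_LR.
  by rewrite ler_wpM2r ?rnorm_ge0// ltW.
apply: (@perturbed_surjective _ _ _ _ C) => // [|x]; first exact: AWb.
have [->|x0] := eqVneq x 0.
  exists 0; [by rewrite !rnorm0 mulr0|by rewrite linear0 subr0 rnorm0 mulr0].
have nx : 0 < rnorm x by rewrite -ltcR rnormE normr_gt0.
have [|w wC wx] := hC x (4^-1 * rnorm x); first by rewrite mulr_gt0.
exists w => //; have := rdistD (AW 0 w) x (AW s w).
rewrite [rnorm (AW 0 w - _)]rdistC.
have : 4^-1 / (C + 1) * rnorm w <= 4^-1 * rnorm x.
  rewrite -mulrA ler_pM2l// mulrC ler_pdivrMr ?ltr_wpDl//.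
  apply: (le_trans wC); rewrite mulrDr mulr1 mulrC; lra.
have := hd w; lra.
Qed.

End Curve.

Theorem corollary2p5 (R : realType) (X W : completeNormedModType R[i])
    (ipX : {dot X for @Num.conj R[i]}) (ipW : {dot W for @Num.conj R[i]})
    (hX : hilbert_dot ipX) (hW : hilbert_dot ipW)
    (A : operator X)
    (A_lin : linear_op A) (A_closed : closed_op A)
    (A_dense : densely_defined A) (A_sym : symmetric_op ipX A)
    (j : {linear W -> X})
    (hDW : domain_setting ipX A j)
    (AW : R -> {linear W -> X})
    (AW_bounded : forall s : R, 0 <= s <= 1 -> bounded_op (AW s))
    (AW_cont : continuous_curve AW)
    (AW0 : forall w : W, AW 0 w = adjoint ipX A (j w))
    (AW0_UCP : weak_inner_UCP j (dom A) (AW 0)) :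
  (exists2 s0 : R, 0 < s0 & forall s : R, 0 <= s <= 1 -> s < s0 ->
     range (AW s) = [set: X])
  /\
  ((forall s : R, 0 <= s <= 1 -> forall x y : W, dom A (j x) ->
      ipX (AW s x) (j y) = ipX (j x) (AW s y)) ->
   exists2 s0 : R, 0 < s0 & forall s : R, 0 <= s <= 1 -> s < s0 ->
     weak_inner_UCP j (dom A) (AW s)).
Proof.
have surj0 :=
  adjoint_on_DW_surjective hX A_lin A_closed A_dense A_sym hDW AW0 AW0_UCP.
have [s0 s00 hs] := surjective_near0 AW_bounded AW_cont surj0.
split=> [|greens]; first by exists s0.
exists s0 => // s s01 ss0; apply/seteqP; split=> [w [/= Aw w0]|_ ->] /=.
  (* Writing [j w] as [AW s v] turns its squared norm into [ipX (AW s w) (j v)], which is 0. *)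
  have [v _ vw] : range (AW s) (j w) by rewrite hs.
  apply: (setting_inj hDW); rewrite linear0; apply/eqP.
  by rewrite -(dnorm_eq0 ipX) -[X in ipX _ X]vw -greens// w0 linear0l.
by rewrite !linear0; split=> //; case: A_lin.
Qed.
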